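(* If $m\ge4$ is even, then there exists a Riemannian metric $g$ on $\mathbb{R}^m$ which is centrally harmonic about the origin, which is not conformally flat, and which has $\Theta_0=r^{m-1}$.
   Context: For a Riemannian manifold $(M,g)$ of dimension $m$ and a point $P$, let $r_P$ be the geodesic distance from $P$, let $\iota_P$ be the injectivity radius at $P$, and let $\xi=(\xi^1,\dots,\xi^m)$ be geodesic (normal) coordinates centered at $P$, given by the exponential map and an orthonormal frame of $T_PM$, so that $r:=r_P(\xi)=\|\xi\|$ for $\|\xi\|<\iota_P$. The volume density in geodesic polar coordinates is $\Theta_P(\xi):=r^{m-1}\tilde\Theta_P(\xi)$ where $\tilde\Theta_P:=\sqrt{\det(g_{ij})}$ in the geodesic coordinates, for $0<r<\iota_P$; $\Theta_0$ is $\Theta_P$ for $P$ the origin. $(M,g)$ is centrally harmonic about $P$ if there exists a non-constant function of the form $f=\check f(r_P)$, smooth away from $P$ and permitted to be singular at $P$, such that $\Delta^0f=0$ for $0<r_P<\iota_P$, where $\Delta^0$ is the Laplace-Beltrami operator of $g$. *)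

(* Defs.v *)
From HB Require Import structures.
From mathcomp Require Import all_boot all_order all_algebra.
From mathcomp Require Import all_classical all_reals all_analysis.

Set Implicit Arguments.
Unset Strict Implicit.
Unset Printing Implicit Defensive.

Import Order.TTheory GRing.Theory Num.Theory.
Import numFieldNormedType.Exports.

Local Open Scope classical_set_scope.
Local Open Scope ring_scope.

(** Riemannian geometry of R^m in its global chart.  A point, or a tangent
    vector, is a row vector in 'rV[R]_m; a metric is a matrix-valued function.
    The library norm on 'rV[R]_m is the sup norm, used here only through its
    topology; Euclidean lengths are given by [enorm]. *)

Section Smoothness.
Variables (R : realType) (m : nat).

Definition partial (i : 'I_m) (f : 'rV[R]_m -> R) : 'rV[R]_m -> R :=
  fun x => 'D_(delta_mx 0 i) f x.

(** C^k on an open set U: the values of f off U are irrelevant. *)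
Fixpoint Ck_on (k : nat) (U : set 'rV[R]_m) (f : 'rV[R]_m -> R) : Prop :=
  (forall x, U x -> {for x, continuous f}) /\
  match k with
  | 0 => True
  | k'.+1 => forall i : 'I_m,
      (forall x, U x -> derivable f x (delta_mx 0 i)) /\
      Ck_on k' U (partial i f)
  end.

Definition smooth_on (U : set 'rV[R]_m) (f : 'rV[R]_m -> R) : Prop :=
  forall k, Ck_on k U f.

Definition smooth_map_on (U : set 'rV[R]_m) (F : 'rV[R]_m -> 'rV[R]_m) : Prop :=
  forall i : 'I_m, smooth_on U (fun x => F x 0 i).

Definition diffeo_onto_image (U : set 'rV[R]_m) (F : 'rV[R]_m -> 'rV[R]_m) :
    Prop :=
  [/\ smooth_map_on U F, open (F @` U) &
      exists G : 'rV[R]_m -> 'rV[R]_m,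
        smooth_map_on (F @` U) G /\ forall x, U x -> G (F x) = x].

Definition enorm (v : 'rV[R]_m) : R := Num.sqrt (\sum_i v 0 i ^+ 2).

End Smoothness.

Section Metric.
Variables (R : realType) (m : nat).
Implicit Types (g : 'rV[R]_m -> 'M[R]_m) (P x v w : 'rV[R]_m).

Definition inner g x v w : R := (v *m g x *m w^T) 0 0.

Definition gnorm g x v : R := Num.sqrt (inner g x v v).

Definition riemannian_metric g : Prop :=
  [/\ forall i j, smooth_on setT (fun x => g x i j),
      forall x, (g x)^T = g x &
      forall x v, v != 0 -> 0 < inner g x v v].

(** [christoffel g k i j] is Gamma^k_{ij}. *)
Definition christoffel g (k i j : 'I_m) : 'rV[R]_m -> R := fun x =>
  2^-1 * \sum_l invmx (g x) k l *
    (partial i (fun y => g y j l) x + partial j (fun y => g y i l) x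
     - partial l (fun y => g y i j) x).

(** Component R_{ijk}^l of R(d_i, d_j) d_k. *)
Definition curvature g (i j k l : 'I_m) : 'rV[R]_m -> R := fun x =>
  partial i (christoffel g l j k) x - partial j (christoffel g l i k) x
  + \sum_n (christoffel g l i n x * christoffel g n j k x
            - christoffel g l j n x * christoffel g n i k x).

Definition flat_on (U : set 'rV[R]_m) g : Prop :=
  forall i j k l x, U x -> curvature g i j k l x = 0.

(** Locally conformal to a flat metric, flat meaning of zero curvature. *)
Definition conformally_flat g : Prop :=
  forall p, exists (U : set 'rV[R]_m) (phi : 'rV[R]_m -> R),
    [/\ open U, U p, smooth_on U phi &
        flat_on U (fun x => expR (2 * phi x) *: g x)].

(** The analyst's sign; only the equation [laplacian g f x = 0] is used. *)
Definition laplacian g (f : 'rV[R]_m -> R) : 'rV[R]_m -> R := fun x =>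
  (Num.sqrt (\det (g x)))^-1 *
  \sum_i partial i (fun y => Num.sqrt (\det (g y)) *
    \sum_j invmx (g y) i j * partial j f y) x.

Definition C1_arc (c : R -> 'rV[R]_m) : Prop :=
  (forall t, derivable c t 1) /\ continuous (derive1 c).

Definition arc_length g (c : R -> 'rV[R]_m) : R :=
  \int[lebesgue_measure]_(t in `[0, 1]) gnorm g (c t) (derive1 c t).

(** A piecewise C^1 curve is a finite chain of C^1 arcs, each traversed for t
    in [0, 1]. *)
Fixpoint joins x (cs : seq (R -> 'rV[R]_m)) y : Prop :=
  match cs with
  | [::] => x = y
  | c :: cs' => [/\ C1_arc c, c 0 = x & joins (c 1) cs' y]
  end.

Definition gdist g P x : R :=
  inf [set L | exists2 cs, joins P cs x & L = \sum_(c <- cs) arc_length g c].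

(** The equation is required on an open interval containing [0, 1]. *)
Definition geodesic g (c : R -> 'rV[R]_m) : Prop :=
  exists2 e : R, 0 < e & forall t, - e < t < 1 + e ->
    [/\ derivable c t 1, derivable (derive1 c) t 1 &
        forall k, derive1 (derive1 c) t 0 k =
          - \sum_i \sum_j christoffel g k i j (c t) *
                          derive1 c t 0 i * derive1 c t 0 j].

Definition exp_rel g P v q : Prop :=
  exists c : R -> 'rV[R]_m, [/\ geodesic g c, c 0 = P, derive1 c 0 = v & c 1 = q].

Definition exp_dom g P : set 'rV[R]_m := [set v | exists q, exp_rel g P v q].

(** Meaningful on [exp_dom g P], where the endpoint is unique. *)
Definition expmap g P v : 'rV[R]_m := get [set q | exp_rel g P v q].

Definition tangent_ball g P (rho : R) : set 'rV[R]_m :=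
  [set v | gnorm g P v < rho].

(** Supremum of the radii on which the exponential map is defined and a
    diffeomorphism onto its image; it may be +oo. *)
Definition injectivity_radius g P : \bar R :=
  ereal_sup [set rho%:E | rho in [set rho : R |
    [/\ 0 < rho, tangent_ball g P rho `<=` exp_dom g P &
        diffeo_onto_image (tangent_ball g P rho) (expmap g P)]]].

(** The rows of A are the vectors of the frame. *)
Definition orthonormal_frame g P (A : 'M[R]_m) : Prop :=
  A *m g P *m A^T = 1%:M.

Definition normal_chart g P (A : 'M[R]_m) (xi : 'rV[R]_m) : 'rV[R]_m :=
  expmap g P (xi *m A).

(** Matrix (g_ij) of the metric in geodesic coordinates; row i of the library
    Jacobian is the i-th partial derivative of the chart. *)
Definition normal_metric g P (A : 'M[R]_m) (xi : 'rV[R]_m) : 'M[R]_m :=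
  let J := jacobian (normal_chart g P A) xi in
  J *m g (normal_chart g P A xi) *m J^T.

Definition volume_density g P (A : 'M[R]_m) (xi : 'rV[R]_m) : R :=
  enorm xi ^+ m.-1 * Num.sqrt (\det (normal_metric g P A xi)).

Definition punctured_ball g P : set 'rV[R]_m :=
  [set x | 0 < gdist g P x /\ ((gdist g P x)%:E < injectivity_radius g P)%E].

(** Non-constancy is required on the punctured ball itself, since f is
    unconstrained elsewhere. *)
Definition centrally_harmonic g P : Prop :=
  exists fc : R -> R, let f := fun x => fc (gdist g P x) in
    [/\ smooth_on (punctured_ball g P) f,
        exists x y, [/\ punctured_ball g P x, punctured_ball g P y & f x != f y] &
        forall x, punctured_ball g P x -> laplacian g f x = 0].

End Metric.

(* Main.v *)
(** Let K and L be the generators of the rotations in two orthogonal coordinate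
    planes, a = xK and b = xL the corresponding fields, and
      g_x(v, v) = |v + <b, v> a|^2,
    that is, g = h^T h with h = 1 + a^T b.  As a, b and x are mutually
    orthogonal, det h = 1 and x g(x) = x.  Hence det g = 1, rays from the origin
    are geodesics, and the distance to the origin is the Euclidean one (Gauss
    lemma).  The two rotations are isometries of g, and conservation of their
    momenta shows that rays are the only geodesics from the origin; so the
    exponential map there is the identity.  Since det g = 1 and g^-1 fixes x, g
    and the flat metric have the same Laplacian on radial functions, and |x|^(2-m)
    is harmonic; for even m it is a rational function.  Finally, in a
    conformally flat metric which is the identity at a point, the curvature
    components with four distinct indices vanish there, while those of g at the
    origin do not. *)

Require Import Defs.
From mathcomp Require Import all_boot all_order all_algebra.
From mathcomp Require Import all_classical all_reals all_analysis.
From mathcomp Require Import ring lra.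
Import Order.TTheory GRing.Theory Num.Theory.
Import numFieldNormedType.Exports.
Set Implicit Arguments.
Unset Strict Implicit.
Unset Printing Implicit Defensive.
Local Open Scope classical_set_scope.
Local Open Scope ring_scope.

(** * Euclidean inner product and rank-one matrices *)

Section Dot.
Variables (R : realType) (m : nat).
Implicit Types (u v w : 'rV[R]_m) (A : 'M[R]_m).

Definition dot u v : R := \sum_i u 0 i * v 0 i.

Lemma dotE u v : dot u v = (u *m v^T) 0 0.
Proof. by rewrite mxE; apply: eq_bigr => i _; rewrite mxE. Qed.

Lemma dotC u v : dot u v = dot v u.
Proof. by apply: eq_bigr => i _; rewrite mulrC. Qed.

Lemma dotDl u v w : dot (u + v) w = dot u w + dot v w.
Proof. by rewrite /dot -big_split; apply: eq_bigr => i _; rewrite mxE mulrDl. Qed.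

Lemma dotZl t u v : dot (t *: u) v = t * dot u v.
Proof. by rewrite /dot mulr_sumr; apply: eq_bigr => i _; rewrite mxE mulrA. Qed.

Lemma dotDr u v w : dot u (v + w) = dot u v + dot u w.
Proof. by rewrite !(dotC u) dotDl. Qed.

Lemma dotZr t u v : dot u (t *: v) = t * dot u v.
Proof. by rewrite !(dotC u) dotZl. Qed.

Lemma dotNl u v : dot (- u) v = - dot u v.
Proof. by rewrite -scaleN1r dotZl mulN1r. Qed.

Lemma dotNr u v : dot u (- v) = - dot u v.
Proof. by rewrite !(dotC u) dotNl. Qed.

Lemma dot0l u : dot 0 u = 0.
Proof. by rewrite -(scale0r 0) dotZl mul0r. Qed.

Lemma dot0r u : dot u 0 = 0.
Proof. by rewrite dotC dot0l. Qed.

Lemma dot_mulmxl u v A : dot (u *m A) v = dot u (v *m A^T).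
Proof. by rewrite !dotE trmx_mul trmxK mulmxA. Qed.

Lemma dot_delta u j : dot u (delta_mx 0 j) = u 0 j.
Proof.
rewrite /dot (bigD1 j) //= big1 ?addr0 ?mxE ?eqxx ?mulr1 // => i ij.
by rewrite mxE (negbTE ij) andbF mulr0.
Qed.

Lemma dot_ge0 u : 0 <= dot u u.
Proof. by apply: sumr_ge0 => i _; rewrite -expr2 sqr_ge0. Qed.

Lemma dot_eq0 u : (dot u u == 0) = (u == 0).
Proof.
apply/idP/eqP => [|->]; last by rewrite dot0l.
rewrite psumr_eq0 => [/allP u0|i _]; last by rewrite -expr2 sqr_ge0.
apply/rowP => i; have := u0 i (mem_index_enum _).
by rewrite /= mulf_eq0 orbb mxE => /eqP.
Qed.

(** The vector [dot u u *: v - dot u v *: u] has squared length [dot u u] times the defect of the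
    inequality. *)
Lemma cauchy_schwarz u v : dot u v ^+ 2 <= dot u u * dot v v.
Proof.
have [->|u0] := eqVneq u 0; first by rewrite !dot0l expr0n mul0r.
have uu : 0 < dot u u by rewrite lt_def dot_eq0 u0 dot_ge0.
have := dot_ge0 (dot u u *: v - dot u v *: u).
rewrite !(dotDl, dotDr, dotNl, dotNr, dotZl, dotZr) (dotC v u).
rewrite [X in 0 <= X](_ : _ = dot u u * (dot u u * dot v v - dot u v ^+ 2)).
  by rewrite pmulr_rge0 // subr_ge0.
by ring.
Qed.

Lemma enormE v : enorm v = Num.sqrt (dot v v).
Proof. by congr Num.sqrt; apply: eq_bigr => i _; rewrite expr2. Qed.

Lemma enormZ t v : enorm (t *: v) = `|t| * enorm v.
Proof. by rewrite !enormE dotZl dotZr mulrA -expr2 sqrtrM ?sqr_ge0// sqrtr_sqr. Qed.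

Lemma enorm_eq0 v : (enorm v == 0) = (v == 0).
Proof. by rewrite enormE sqrtr_eq0 -dot_eq0 eq_le dot_ge0 andbT. Qed.

Lemma mulmx_outer u v w : w *m (u^T *m v) = dot w u *: v.
Proof. by rewrite mulmxA [w *m _]mx11_scalar -dotE mul_scalar_mx. Qed.

(** Matrix determinant lemma: multiplication by unipotent block matrices moves the rank-one term
    from the [m] by [m] block to the 1 by 1 block. *)
Lemma det_1_outer u v : \det (1%:M + u^T *m v) = 1 + dot v u.
Proof.
have E : block_mx 1%:M 0 v 1%:M *m block_mx (1%:M + u^T *m v) u^T 0 1%:M
          *m block_mx 1%:M 0 (- v) 1%:M
       = block_mx 1%:M u^T 0 (1%:M + v *m u^T) :> 'M[R]_(m + 1).
  rewrite !mulmx_block !(mul1mx, mulmx1, mul0mx, mulmx0, addr0, add0r).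
  congr block_mx; first by rewrite mulmxN addrK.
    by rewrite mulmxDr mulmx1 mulmxN mulmxDl mul1mx mulmxA [_ + v]addrC subrr.
  by rewrite addrC.
have /(congr1 determinant) := E.
rewrite !det_mulmx !det_lblock !det_ublock !det1 !mulr1 !mul1r => ->.
by rewrite det_mx11 !mxE eqxx dotE mxE.
Qed.

End Dot.

(** * Pointwise algebra of the twisted metric *)

Section TwistedMetric.
Variables (R : realType) (m : nat) (K L : 'M[R]_m).
Hypotheses (KT : K^T = - K) (LT : L^T = - L) (KL : K *m L = 0).
Implicit Types (x u v w : 'rV[R]_m).

(** As vectors are rows, the map sending [v] to [v + <b, v> a] is right multiplication by the
    transpose of this matrix. *)
Definition twist x : 'M[R]_m := 1%:M + (x *m K)^T *m (x *m L).
Definition metric x : 'M[R]_m := (twist x)^T *m twist x.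

Lemma LK : L *m K = 0.
Proof. by rewrite -[L *m K]trmxK trmx_mul KT LT mulmxN mulNmx KL !oppr0 trmx0. Qed.

Lemma dot_skewK u v : dot (u *m K) v = - dot u (v *m K).
Proof. by rewrite dot_mulmxl KT mulmxN dotNr. Qed.

Lemma dot_skewL u v : dot (u *m L) v = - dot u (v *m L).
Proof. by rewrite dot_mulmxl LT mulmxN dotNr. Qed.

Lemma dot_skewK0 u : dot (u *m K) u = 0.
Proof. by have := dot_skewK u u; rewrite [dot u _]dotC; lra. Qed.

Lemma dot_skewL0 u : dot (u *m L) u = 0.
Proof. by have := dot_skewL u u; rewrite [dot u _]dotC; lra. Qed.

(** The images of [K] and [L] are orthogonal because [L *m K = 0]. Two different vectors are allowed
    since position is later paired with velocity. *)
Lemma dot_KL u v : dot (u *m K) (v *m L) = 0.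
Proof. by rewrite dot_mulmxl KT -mulmxA mulmxN LK oppr0 mulmx0 dot0r. Qed.

Lemma dot_LK u v : dot (u *m L) (v *m K) = 0.
Proof. by rewrite dotC dot_KL. Qed.

Lemma trmx_metric x : (metric x)^T = metric x.
Proof. by rewrite /metric trmx_mul trmxK. Qed.

Lemma det_metric x : \det (metric x) = 1.
Proof. by rewrite /metric det_mulmx det_tr /twist det_1_outer dot_LK addr0 mulr1. Qed.

Lemma metric_unit x : metric x \in unitmx.
Proof. by rewrite unitmxE det_metric unitr1. Qed.

Lemma trmx_twist x : (twist x)^T = 1%:M + (x *m L)^T *m (x *m K).
Proof. by rewrite /twist linearD /= trmx1 trmx_mul trmxK. Qed.

Lemma mulmx_twistT v x :
  v *m (twist x)^T = v + dot v (x *m L) *: (x *m K).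
Proof. by rewrite trmx_twist mulmxDr mulmx1 mulmx_outer. Qed.

Lemma mulmx_twist v x :
  v *m twist x = v + dot v (x *m K) *: (x *m L).
Proof. by rewrite /twist mulmxDr mulmx1 mulmx_outer. Qed.

Lemma mulmx_metric v x :
  v *m metric x = v + dot v (x *m L) *: (x *m K)
    + (dot v (x *m K) + dot (x *m K) (x *m K) * dot v (x *m L)) *: (x *m L).
Proof.
rewrite /metric mulmxA mulmx_twistT mulmx_twist dotDl dotZl.
by rewrite [_ * dot (x *m K) _]mulrC.
Qed.

Lemma metric_radial x t : (t *: x) *m metric x = t *: x.
Proof.
by rewrite mulmx_metric !dotZl -![dot x _]dotC dot_skewK0 dot_skewL0 !mulr0 addr0 !scale0r !addr0.
Qed.

Lemma metric0 : metric 0 = 1%:M.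
Proof. by rewrite /metric /twist !mul0mx trmx0 mul0mx addr0 trmx1 mulmx1. Qed.

Lemma inner_metric x v :
  inner metric x v v = dot (v *m (twist x)^T) (v *m (twist x)^T).
Proof. by rewrite /inner /metric dotE trmx_mul trmxK !mulmxA. Qed.

Lemma inner_metric_gt0 x v : v != 0 -> 0 < inner metric x v v.
Proof.
move=> v0; rewrite inner_metric lt_def dot_ge0 dot_eq0 andbT.
apply: contra v0 => /eqP E.
have: v *m (twist x)^T *m invmx (twist x)^T = 0 by rewrite E mul0mx.
rewrite mulmxK => [->//|].
by rewrite unitmx_tr unitmxE /twist det_1_outer dot_LK addr0 unitr1.
Qed.

Lemma metricE x i j : metric x i j =
  (i == j)%:R + (x *m K) 0 i * (x *m L) 0 j + (x *m L) 0 i * (x *m K) 0 j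
  + dot (x *m K) (x *m K) * ((x *m L) 0 i * (x *m L) 0 j).
Proof.
have -> : metric x i j = ((delta_mx 0 i : 'rV_m) *m metric x) 0 j by rewrite -rowE [RHS]mxE.
rewrite mulmx_metric ![dot (delta_mx 0 i) _]dotC ?dot_delta.
move: (x *m K) (x *m L) => a b; set d := dot a a.
rewrite !mxE /= [j == i]eq_sym.
by ring.
Qed.

(** As [x *m K] and [x *m L] are orthogonal, both rank-one terms [k] and [l] square to zero, so the
    factors [1 + k] and [1 + l] of the metric are inverted by [1 - k] and [1 - l]. *)
Lemma invmx_metric x : invmx (metric x) =
  (1%:M - (x *m K)^T *m (x *m L)) *m (1%:M - (x *m L)^T *m (x *m K)).
Proof.
have KK : (x *m K)^T *m (x *m L) *m ((x *m K)^T *m (x *m L)) = 0.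
  rewrite -mulmxA mulmx_outer.
  by rewrite dot_LK scale0r mulmx0.
have LL : (x *m L)^T *m (x *m K) *m ((x *m L)^T *m (x *m K)) = 0.
  by rewrite -mulmxA mulmx_outer dot_KL scale0r mulmx0.
have H : (1%:M - (x *m K)^T *m (x *m L)) *m (1%:M - (x *m L)^T *m (x *m K)) *m metric x = 1%:M.
  rewrite /metric trmx_twist /twist.
  move: KK LL; set k := (x *m K)^T *m _; set l := (x *m L)^T *m _ => KK LL.
  rewrite mulmxA -[X in X *m _ = _]mulmxA [X in _ *m X *m _](_ : _ = 1%:M); last first.
    by rewrite mulmxDr mulmx1 mulmxBl mul1mx LL subr0 subrK.
  by rewrite mulmx1 mulmxDr mulmx1 mulmxBl mul1mx KK subr0 subrK.
by rewrite -[RHS](mulmxK (metric_unit x)) H mul1mx.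
Qed.

End TwistedMetric.

(** * Calculus of directional derivatives *)

Section PointwiseDerivative.
Variables (R : realType) (V : normedModType R).
Implicit Types (x v : V) (f g : V -> R).

Lemma is_derive_add f g x v df dg : is_derive x v f df -> is_derive x v g dg ->
  is_derive x v (fun y => f y + g y) (df + dg).
Proof. exact: is_deriveD. Qed.

Lemma is_derive_opp f x v df : is_derive x v f df ->
  is_derive x v (fun y => - f y) (- df).
Proof. exact: is_deriveN. Qed.

Lemma is_derive_mul f g x v df dg : is_derive x v f df -> is_derive x v g dg ->
  is_derive x v (fun y => f y * g y) (df * g x + f x * dg).
Proof.
move=> Df Dg; apply: is_derive_eq (is_deriveM Df Dg) _.
by rewrite addrC /GRing.scale /= mulrC.
Qed.

Lemma is_derive_const (c : R) x v : is_derive x v (fun=> c) 0.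
Proof. exact: is_derive_cst. Qed.

Lemma is_derive_scale c f x v df : is_derive x v f df ->
  is_derive x v (fun y => c * f y) (c * df).
Proof.
by move=> Df; apply: is_derive_eq (is_derive_mul (is_derive_const c x v) Df) _; rewrite mul0r add0r.
Qed.

Lemma is_derive_bigsum n (F : 'I_n -> V -> R) x v (dF : 'I_n -> R) :
  (forall i, is_derive x v (F i) (dF i)) ->
  is_derive x v (fun y => \sum_i F i y) (\sum_i dF i).
Proof. by move=> DF; rewrite -fct_sumE; exact: is_derive_sum. Qed.

Lemma is_derive_inv f x v df : f x != 0 -> is_derive x v f df ->
  is_derive x v (fun y => (f y)^-1) (- (f x) ^- 2 * df).
Proof.
move=> fx0 [Df <-]; apply: DeriveDef; first exact: derivableV.
by rewrite deriveV.
Qed.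

(** Chain rule with a scalar outer function, reduced to the one-variable rule along the line
    [t *: v + x]. *)
Lemma is_derive_comp (h : R -> R) f x v dh df :
  is_derive (f x) 1 h dh -> is_derive x v f df ->
  is_derive x v (fun y => h (f y)) (dh * df).
Proof.
move=> Dh [/derivable1P Df <-].
have Dp : is_derive (0 : R) 1 (fun t => f (t *: v + x)) ('D_v f x).
  apply: (DeriveDef Df); rewrite /derive.
  set g1 := fun t => t^-1 *: _; set g2 := fun t => t^-1 *: _.
  suff -> : g1 = g2 by []; apply/funext => t; rewrite /g1 /g2 /=.
  by rewrite addr0 scale0r add0r [_ *: 1]mulr1.
have Dh' : is_derive (f (0 *: v + x)) 1 h dh by rewrite scale0r add0r.
have [H1 H2] := is_derive1_comp Dh' Dp.
have H3 : derivable (fun y => h (f y)) x v by exact/derivable1P.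
apply: (DeriveDef H3); rewrite -H2 /derive.
set g1 := fun t => t^-1 *: _; set g2 := fun t => t^-1 *: _.
suff -> : g1 = g2 by []; apply/funext => t; rewrite /g1 /g2 /=.
by rewrite addr0 scale0r add0r [_ *: 1]mulr1.
Qed.

Lemma is_derive_entry m n (F : V -> 'M[R]_(m, n)) x v dF i j :
  is_derive x v F dF -> is_derive x v (fun y => F y i j) (dF i j).
Proof.
move=> [DF <-]; apply: DeriveDef; first exact: (derivable_mxP _ _ _).1.
by rewrite derive_mx // mxE.
Qed.

Lemma is_derive_mx m n (F : V -> 'M[R]_(m, n)) x v (dF : 'M[R]_(m, n)) :
  (forall i j, is_derive x v (fun y => F y i j) (dF i j)) -> is_derive x v F dF.
Proof.
move=> DF; have DF' : derivable F x v by apply/derivable_mxP => i j; have [] := DF i j.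
apply: DeriveDef => //; rewrite derive_mx //; apply/matrixP => i j; rewrite mxE.
by have [] := DF i j.
Qed.

Lemma is_derive_mulmx m n (F : V -> 'rV[R]_m) (A : 'M[R]_(m, n)) x v dF :
  is_derive x v F dF -> is_derive x v (fun y => F y *m A) (dF *m A).
Proof.
move=> DF; apply: is_derive_mx => i j; rewrite mxE.
under eq_fun do rewrite mxE.
apply: is_derive_bigsum => k.
under eq_fun do rewrite mulrC.
by rewrite mulrC; apply: is_derive_scale; exact: is_derive_entry.
Qed.

Lemma is_derive_dot m (F G : V -> 'rV[R]_m) x v dF dG :
  is_derive x v F dF -> is_derive x v G dG ->
  is_derive x v (fun y => dot (F y) (G y)) (dot dF (G x) + dot (F x) dG).
Proof.
move=> DF DG; rewrite /dot -big_split; apply: is_derive_bigsum => i.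
by apply: is_derive_mul; exact: is_derive_entry.
Qed.

End PointwiseDerivative.

Lemma linear_rowE (R : realType) m (f : 'rV[R]_m -> R) :
  (forall t u w, f (t *: u + w) = t * f u + f w) ->
  forall v, f v = \sum_i v 0 i * f (delta_mx 0 i).
Proof.
move=> fl v; rewrite {1}[v]row_sum_delta.
have f0 : f 0 = 0 by have := fl (-1) 0 0; rewrite scaler0 addr0 mulN1r addNr.
elim/big_ind2 : _ => // [_ u _ w <- <-|i _].
  by have := fl 1 u w; rewrite scale1r mul1r.
by have := fl (v 0 i) (delta_mx 0 i) 0; rewrite f0 !addr0.
Qed.

(** * First derivatives of the metric and the geodesic equation *)

Section MetricDerivative.
Variables (R : realType) (m : nat) (K L : 'M[R]_m).
Hypotheses (KT : K^T = - K) (LT : L^T = - L) (KL : K *m L = 0).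
Implicit Types (x u v w : 'rV[R]_m).

(** Derivative of the metric entry [i j] at [x] along [u], read off [metricE] by the product rule,
    [x *m K] and [x *m L] being linear in [x]. *)
Definition dmetric u x (i j : 'I_m) : R :=
  let a := x *m K in let b := x *m L in
  let da := u *m K in let db := u *m L in
  (da 0 i * b 0 j + a 0 i * db 0 j) + (db 0 i * a 0 j + b 0 i * da 0 j)
  + ((dot da a + dot a da) * (b 0 i * b 0 j)
     + dot a a * (db 0 i * b 0 j + b 0 i * db 0 j)).

Lemma is_derive_metric x u i j :
  is_derive x u (fun y => metric K L y i j) (dmetric u x i j).
Proof.
under eq_fun do rewrite metricE//.
have D A k : is_derive x u (fun y : 'rV_m => (y *m A) 0 k) ((u *m A) 0 k).
  exact: is_derive_entry (is_derive_mulmx A (is_derive_id x u)).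
have DA A : is_derive x u (fun y : 'rV_m => y *m A) (u *m A).
  exact: is_derive_mulmx (is_derive_id x u).
rewrite /dmetric /= -[X in X + _ + _]add0r.
apply: is_derive_add; [apply: is_derive_add; [apply: is_derive_add|]|].
- exact: is_derive_mul.
- exact: is_derive_mul.
- apply: is_derive_mul; first exact: is_derive_dot.
  exact: is_derive_mul.
Qed.

Lemma partial_metric x l i j :
  partial l (fun y => metric K L y i j) x = dmetric (delta_mx 0 l) x i j.
Proof. by have [] := is_derive_metric x (delta_mx 0 l) i j. Qed.

Lemma dmetric_linear x i j t u w :
  dmetric (t *: u + w) x i j = t * dmetric u x i j + dmetric w x i j.
Proof.
rewrite /dmetric !mulmxDl -!scalemxAl !(dotDl, dotDr, dotZl, dotZr).
move: (x *m K) (x *m L) (u *m K) (u *m L) (w *m K) (w *m L) => a b uK uL wK wL.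
rewrite !mxE.
by ring.
Qed.

Lemma dmetric_contract u v x j : \sum_i v 0 i * dmetric u x i j =
  let a := x *m K in let b := x *m L in
  let da := u *m K in let db := u *m L in
  (dot v da * b 0 j + dot v a * db 0 j) + (dot v db * a 0 j + dot v b * da 0 j)
  + ((dot da a + dot a da) * (dot v b * b 0 j)
     + dot a a * (dot v db * b 0 j + dot v b * db 0 j)).
Proof.
set a := x *m K; set b := x *m L; set da := u *m K; set db := u *m L => /=.
pose r := (b 0 j *: da + db 0 j *: a) + (a 0 j *: db + da 0 j *: b)
  + (((dot da a + dot a da) * b 0 j) *: b + dot a a *: (b 0 j *: db + db 0 j *: b)).
transitivity (dot v r).
  apply: eq_bigr => i _; congr (_ * _).
  rewrite /dmetric /r -/a -/b -/da -/db /=.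
  move: a b da db {r} => a b da db; rewrite !mxE.
  by ring.
rewrite /r !(dotDr, dotZr).
by ring.
Qed.

(** The Christoffel symbol of the first kind contracted twice with [v]. Keeping its index lowered
    keeps the inverse metric out of the equation of motion. *)
Definition geodesic_force x v : 'rV[R]_m :=
  let a := x *m K in let b := x *m L in
  let da := v *m K in let db := v *m L in
  2 * dot v b *: da + 2 * dot v a *: db + 2 * dot a da * dot v b *: b
  + 2 * dot a a * dot v b *: db + dot v b ^+ 2 *: (a *m K).

Lemma christoffel_contract x v k :
  \sum_i \sum_j christoffel (metric K L) k i j x * v 0 i * v 0 j =
  (geodesic_force x v *m invmx (metric K L x)) 0 k.
Proof.
pose E i j l := dmetric (delta_mx 0 i) x j l + dmetric (delta_mx 0 j) x i l
  - dmetric (delta_mx 0 l) x i j.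
have CE i j : christoffel (metric K L) k i j x =
    2^-1 * \sum_l invmx (metric K L x) k l * E i j l.
  congr (_ * _); apply: eq_bigr => l _; congr (_ * _).
  by rewrite !partial_metric.
have S1 l : \sum_i \sum_j dmetric (delta_mx 0 i) x j l * (v 0 i * v 0 j) =
    \sum_j v 0 j * dmetric v x j l.
  rewrite exchange_big /=; apply: eq_bigr => j _.
  rewrite (linear_rowE (dmetric_linear x j l) v) mulr_sumr.
  by apply: eq_bigr => i _; ring.
have S2 l : \sum_i \sum_j dmetric (delta_mx 0 j) x i l * (v 0 i * v 0 j) =
    \sum_j v 0 j * dmetric v x j l.
  rewrite -S1 exchange_big /=; apply: eq_bigr => i _; apply: eq_bigr => j _.
  by rewrite [v 0 i * _]mulrC.
have S3 l : \sum_i \sum_j dmetric (delta_mx 0 l) x i j * (v 0 i * v 0 j) =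
    \sum_j v 0 j * \sum_i v 0 i * dmetric (delta_mx 0 l) x i j.
  rewrite exchange_big /=; apply: eq_bigr => j _; rewrite mulr_sumr.
  by apply: eq_bigr => i _; ring.
(* By symmetry in [i] and [j] the first two terms of [E] have the same contraction with [v]. *)
have SE l : \sum_i \sum_j E i j l * (v 0 i * v 0 j) = 2 * geodesic_force x v 0 l.
  transitivity (\sum_j v 0 j * dmetric v x j l + \sum_j v 0 j * dmetric v x j l
     - \sum_j v 0 j * \sum_i v 0 i * dmetric (delta_mx 0 l) x i j).
    rewrite -{1}S1 -S2 -S3 -big_split -sumrB; apply: eq_bigr => i _ /=.
    by rewrite -big_split -sumrB; apply: eq_bigr => j _ /=; rewrite /E; ring.
  rewrite dmetric_contract /=.
  under eq_bigr do rewrite dmetric_contract /=.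
  set a := x *m K; set b := x *m L; set dl := delta_mx 0 l.
  pose r := dot v (dl *m K) *: b + dot v a *: (dl *m L)
   + (dot v (dl *m L) *: a + dot v b *: (dl *m K))
   + ((dot (dl *m K) a + dot a (dl *m K)) * dot v b *: b
      + dot a a *: (dot v (dl *m L) *: b + dot v b *: (dl *m L))).
  rewrite (_ : \sum_i _ = dot v r); last first.
    apply: eq_bigr => i _; congr (_ * _); rewrite /r.
    move: a b (dl *m K) (dl *m L) {r} => a b da db; rewrite !mxE.
    by ring.
  (* Skew-symmetry moves [K] and [L] off the basis vector, turning each pairing into a
     coordinate. *)
  have vK : dot v (dl *m K) = - (v *m K) 0 l.
    by rewrite dotC dot_skewK // dotC dot_delta.
  have vL : dot v (dl *m L) = - (v *m L) 0 l.
    by rewrite dotC dot_skewL // dotC dot_delta.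
  have aK : dot a (dl *m K) = - (a *m K) 0 l.
    by rewrite dotC dot_skewK // dotC dot_delta.
  rewrite /r /geodesic_force -/a -/b !(dotDr, dotZr) [dot (dl *m K) a]dotC.
  rewrite vK vL aK [dot v (v *m K)]dotC [dot v (v *m L)]dotC dot_skewK0 // dot_skewL0 //.
  rewrite [dot (v *m K) a]dotC.
  move: (a *m K) => aa; move: a b (v *m K) (v *m L) {r vK vL aK} => a b da db.
  rewrite !mxE.
  by field.
transitivity (\sum_l invmx (metric K L x) k l * geodesic_force x v 0 l); last first.
  rewrite mxE; apply: eq_bigr => l _; rewrite mulrC; congr (_ * _).
  by rewrite -[in LHS]trmx_metric -trmx_inv mxE.
under eq_bigr => i _ do under eq_bigr => j _ do rewrite CE mulr_sumr !mulr_suml.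
under eq_bigr => i _ do rewrite exchange_big /=.
rewrite exchange_big /=; apply: eq_bigr => l _.
have -> : geodesic_force x v 0 l = 2^-1 * \sum_i \sum_j E i j l * (v 0 i * v 0 j).
  by rewrite SE mulrA mulVf ?mul1r // pnatr_eq0.
rewrite 2!mulr_sumr; apply: eq_bigr => i _; rewrite 2!mulr_sumr; apply: eq_bigr => j _.
by ring.
Qed.

Lemma geodesic_force_metric x v w :
  w *m metric K L x = - geodesic_force x v <->
  w = - (geodesic_force x v *m invmx (metric K L x)).
Proof.
have U := metric_unit KT LT KL x.
split => [E|->]; last by rewrite mulNmx mulmxKV.
by rewrite -mulNmx -E mulmxK.
Qed.

End MetricDerivative.

(** * Geodesics from the origin and the exponential map *)

Section Geodesics.
Variables (R : realType) (m : nat) (K L : 'M[R]_m).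
Hypotheses (KT : K^T = - K) (LT : L^T = - L) (KL : K *m L = 0).
Implicit Types (x u v w : 'rV[R]_m).

Let g := metric K L.

(** Mean value theorem on [[0, t]]. A geodesic satisfies its equation on a neighbourhood of
    [[0, 1]], so two-sided derivatives are available at both ends. *)
Lemma constant_on_unit (f : R -> R) :
  (forall t : R, 0 <= t <= 1 -> is_derive t 1 f 0) ->
  forall t : R, 0 <= t <= 1 -> f t = f 0.
Proof.
move=> Df t /andP[t0 t1].
have Dft (s : R) : s \in `[0, t] -> is_derive s 1 f 0.
  by rewrite in_itv /= => /andP[s0 st]; apply: Df; rewrite s0 (le_trans st).
have Dfo (s : R) : s \in `]0, t[ -> is_derive s 1 f ((fun=> 0) s).
  by move=> st; apply: Dft; exact: subset_itv_oo_cc.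
have cf : {within `[0, t], continuous f}.
  by apply: derivable_within_continuous => s /Dft[].
have [s _] := MVT_segment t0 Dfo cf.
by rewrite mul0r => /eqP; rewrite subr_eq0 => /eqP.
Qed.

Lemma is_derive_ray v (t : R) : is_derive t 1 (fun s : R => s *: v) v.
Proof.
apply: is_derive_mx => i j; under eq_fun do rewrite mxE.
apply: is_derive_eq (is_derive_mul (is_derive_id t 1) (is_derive_const (v i j) t 1)) _.
by rewrite mul1r mulr0 addr0.
Qed.

(** Each term of the force at [x] has a factor [dot v (x *m K)] or [dot v (x *m L)], and for
    [x = t *: v] both vanish by skew-symmetry. *)
Lemma geodesic_force_ray v (t : R) : geodesic_force K L (t *: v) v = 0.
Proof.
rewrite /geodesic_force -!scalemxAl !dotZr ![dot v _]dotC dot_skewK0 // dot_skewL0 //.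
by rewrite !(mulr0, expr0n, scale0r, addr0).
Qed.

Lemma geodesic_ray v : geodesic g (fun t => t *: v).
Proof.
exists 1 => // t _.
have D1 : derive1 (fun s : R => s *: v) = fun=> v.
  by apply/funext => s; rewrite derive1E; have [] := is_derive_ray v s.
rewrite D1; split.
- by have [] := is_derive_ray v t.
- exact: derivable_cst.
move=> k; rewrite christoffel_contract // geodesic_force_ray mul0mx.
by rewrite derive1_cst !mxE oppr0.
Qed.

(* The rotations generated by K and L are isometries; their momenta vanish at
   the origin, hence along c, which kills the force. *)
Lemma geodesic_from_0 c v : geodesic g c -> c 0 = 0 -> derive1 c 0 = v ->
  c 1 = v.
Proof.
move=> [e e0 gc] c0 dc0.
have gc' (t : R) : 0 <= t <= 1 -> [/\ is_derive t 1 c (derive1 c t),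
    is_derive t 1 (derive1 c) (derive1 (derive1 c) t) &
    derive1 (derive1 c) t *m g (c t) = - geodesic_force K L (c t) (derive1 c t)].
  move=> /andP[t0 t1]; have [|D1 D2 E] := gc t; first by apply/andP; split; lra.
  have /derivableP := D1; have /derivableP := D2; rewrite -!derive1E => D2' D1'.
  split=> //.
  apply/(geodesic_force_metric KT LT KL); apply/rowP => k.
  by rewrite E christoffel_contract // [RHS]mxE.
pose p := derive1 c; pose q := derive1 p.
pose a t := c t *m K; pose b t := c t *m L.
pose alpha t := dot (p t) (a t); pose beta t := dot (p t) (b t).
have Da (t : R) : 0 <= t <= 1 -> is_derive t 1 a (p t *m K).
  by move=> /gc'[Dc _ _]; exact: is_derive_mulmx.
have Db (t : R) : 0 <= t <= 1 -> is_derive t 1 b (p t *m L).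
  by move=> /gc'[Dc _ _]; exact: is_derive_mulmx.
have Dalpha (t : R) : 0 <= t <= 1 -> is_derive t 1 alpha (dot (q t) (a t)).
  move=> t01; have [_ Dp _] := gc' _ t01.
  apply: is_derive_eq (is_derive_dot Dp (Da t t01)) _.
  by rewrite [dot (p t) (p t *m K)]dotC dot_skewK0 // addr0.
have Dbeta (t : R) : 0 <= t <= 1 -> is_derive t 1 beta (dot (q t) (b t)).
  move=> t01; have [_ Dp _] := gc' _ t01.
  apply: is_derive_eq (is_derive_dot Dp (Db t t01)) _.
  by rewrite [dot (p t) (p t *m L)]dotC dot_skewL0 // addr0.
pose gamma t := dot (a t) (p t *m K); pose delta t := dot (b t) (p t *m L).
pose A t := dot (a t) (a t); pose B t := dot (b t) (b t).
(* The geodesic equation paired with the field [a]; [Eb] is its pairing with [b]. *)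
have Ea (t : R) : 0 <= t <= 1 ->
    dot (q t) (a t) + dot (q t) (b t) * A t = - (2 * beta t * gamma t).
  move=> t01; have [_ _ /(congr1 (fun w => dot w (a t)))] := gc' t t01.
  rewrite /= mulmx_metric // /geodesic_force /= -/(a t) -/(b t) -/p -/q.
  rewrite !(dotDl, dotNl, dotZl) /a /b !(dot_LK KT LT KL) (dot_skewK0 KT) [dot (p t *m K) _]dotC.
  by rewrite /A /gamma /alpha /beta /a /b; lra.
have Eb (t : R) : 0 <= t <= 1 -> dot (q t) (b t)
    + (dot (q t) (a t) + A t * dot (q t) (b t)) * B t =
    - (2 * alpha t * delta t + 2 * gamma t * beta t * B t + 2 * A t * beta t * delta t).
  move=> t01; have [_ _ /(congr1 (fun w => dot w (b t)))] := gc' t t01.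
  rewrite /= mulmx_metric // /geodesic_force /= -/(a t) -/(b t) -/p -/q.
  rewrite !(dotDl, dotNl, dotZl) /a /b !(dot_KL KT LT KL) [dot (p t *m L) _]dotC.
  by rewrite /A /B /gamma /delta /alpha /beta /a /b; lra.
(* [alpha + A * beta] is the momentum for [K], that is, the inner product of [p] and [a] in [g];
   [Ea] says that its derivative vanishes. *)
have p1 (t : R) : 0 <= t <= 1 -> alpha t + A t * beta t = 0.
  move=> t01; transitivity (alpha 0 + A 0 * beta 0); last first.
    by rewrite /alpha /A /beta /a /b c0 !mul0mx !dot0r mul0r addr0.
  apply: (@constant_on_unit (fun t => alpha t + A t * beta t)) t01 => s s01.
  have DA := is_derive_dot (Da s s01) (Da s s01).
  apply: is_derive_eq (is_derive_add (Dalpha s s01) (is_derive_mul DA (Dbeta s s01))) _.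
  have := Ea s s01; rewrite [dot (p s *m K) (a s)]dotC -/(gamma s) -/(A s).
  by lra.
(* The momentum for [L] is [beta + B * (alpha + A * beta)], which reduces to [beta] because the
   first momentum is zero. *)
have b0 (t : R) : 0 <= t <= 1 -> beta t = 0.
  move=> t01; transitivity (beta 0); last by rewrite /beta /b c0 mul0mx dot0r.
  apply: constant_on_unit t01 => s s01.
  apply: is_derive_eq (Dbeta s s01) _.
  have Es : dot (q s) (a s) = - (2 * beta s * gamma s) - dot (q s) (b s) * A s.
    by have := Ea s s01; lra.
  have := Eb s s01; rewrite Es.
  have -> : alpha s = - (A s * beta s) by have := p1 s s01; lra.
  by lra.
have a0 (t : R) : 0 <= t <= 1 -> alpha t = 0.
  by move=> t01; have := p1 t t01; rewrite b0 // mulr0 addr0.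
have q0 (t : R) : 0 <= t <= 1 -> q t = 0.
  move=> t01; have [_ _] := gc' t t01; rewrite -/p -/q /geodesic_force.
  rewrite -/(a t) -/(b t) -/(alpha t) -/(beta t) a0 // b0 //.
  rewrite !(mulr0, mul0r, expr0n, scale0r, addr0) oppr0 => E.
  by rewrite -[q t](mulmxK (metric_unit KT LT KL (c t))) E mul0mx.
have pv (t : R) i : 0 <= t <= 1 -> p t 0 i = v 0 i.
  move=> t01; rewrite -dc0; apply: (@constant_on_unit (fun t => p t 0 i)) t01 => s s01.
  have [_ Dp _] := gc' _ s01.
  by apply: is_derive_eq (is_derive_entry 0 i Dp) _; rewrite -/p -/q q0 // mxE.
apply/rowP => i.
(* The velocity is constantly [v], so [c t - t *: v] is constant; its values at 1 and 0 are
   compared. *)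
have : c 1 0 i - 1 * v 0 i = c 0 0 i - 0 * v 0 i.
  apply: (@constant_on_unit (fun t => c t 0 i - t * v 0 i)); last by rewrite ler01 lexx.
  move=> s s01; have [Dc _ _] := gc' _ s01.
  apply: is_derive_eq (is_derive_add (is_derive_entry 0 i Dc)
    (is_derive_opp (is_derive_mul (is_derive_id s 1) (is_derive_const (v 0 i) s 1)))) _.
  by rewrite -/p pv // mulr0 addr0 mul1r subrr.
by rewrite c0 mxE mul0r mul1r subr0 => /eqP; rewrite subr_eq0 => /eqP.
Qed.

Lemma exp_rel_ray v : exp_rel g 0 v v.
Proof.
exists (fun t => t *: v); split; rewrite ?scale0r ?scale1r //.
  exact: geodesic_ray.
by rewrite derive1E; have [] := is_derive_ray v 0.
Qed.

(** [get] selects some endpoint: the ray shows that one exists, and [geodesic_from_0] that it is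
    [v]. *)
Lemma expmap_id : expmap g 0 = id.
Proof.
apply/funext => v; rewrite /expmap.
have [c [gc c0 dc0 <-]] : exp_rel g 0 v (get [set q | exp_rel g 0 v q]).
  exact: (getPex (ex_intro [set q | exp_rel g 0 v q] v (exp_rel_ray v))).
exact: geodesic_from_0 dc0.
Qed.

Lemma gnorm0 v : Defs.gnorm g 0 v = enorm v.
Proof. by rewrite /Defs.gnorm inner_metric /twist !mul0mx mulmx0 addr0 trmx1 mulmx1 enormE. Qed.

End Geodesics.

(** * Continuity of pairings and matrix products *)

Section ContinuousDot.
Variables (R : realType) (T : topologicalType) (m : nat).

Lemma continuous_dot (F G : T -> 'rV[R]_m) t :
  (forall i, {for t, continuous (fun s => F s 0 i)}) ->
  (forall i, {for t, continuous (fun s => G s 0 i)}) ->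
  {for t, continuous (fun s => dot (F s) (G s))}.
Proof.
move=> cF cG; apply: cvg_big; first exact: add_continuous.
by move=> i _; apply: cvgM; [exact: cF|exact: cG].
Qed.

Lemma continuous_mulmx_entry n (F : T -> 'rV[R]_m) (A : 'M[R]_(m, n)) t j :
  (forall i, {for t, continuous (fun s => F s 0 i)}) ->
  {for t, continuous (fun s => (F s *m A) 0 j)}.
Proof.
move=> cF; rewrite (_ : (fun s => _) = fun s => \sum_k F s 0 k * A k j); last first.
  by apply/funext => s; rewrite mxE.
apply: cvg_big; first exact: add_continuous.
by move=> i _; apply: cvgM; [exact: cF|exact: cvg_cst].
Qed.

End ContinuousDot.

(** * Distance to the origin *)

Section Distance.
Variables (R : realType) (m : nat) (K L : 'M[R]_m).
Hypotheses (KT : K^T = - K) (LT : L^T = - L) (KL : K *m L = 0).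
Implicit Types (x u v w : 'rV[R]_m).

Let g := metric K L.

(** The twist changes [v] only by a multiple of [x *m K], which is orthogonal to [x]; the Euclidean
    inequality then applies. This is the form of the Gauss lemma that bounds lengths from below. *)
Lemma gauss_cauchy_schwarz x v : dot x v <= enorm x * Defs.gnorm g x v.
Proof.
rewrite /Defs.gnorm inner_metric; set w := v *m _.
have -> : dot x v = dot x w.
  by rewrite /w mulmx_twistT dotDr dotZr [dot x (x *m K)]dotC dot_skewK0 // mulr0 addr0.
rewrite enormE -sqrtrM ?dot_ge0 //.
apply: le_trans (ler_norm _) _; rewrite -sqrtr_sqr.
by apply: ler_wsqrtr; exact: cauchy_schwarz.
Qed.

Lemma gnorm_ray x (t : R) : Defs.gnorm g (t *: x) x = enorm x.
Proof.
rewrite /Defs.gnorm inner_metric mulmx_twistT -!scalemxAl !dotZr.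
by rewrite [dot x (x *m L)]dotC dot_skewL0 // mulr0 scale0r addr0 enormE.
Qed.

Lemma arc_length_ray x : arc_length g (fun t => t *: x) = enorm x.
Proof.
have D1 : derive1 (fun s : R => s *: x) = fun=> x.
  by apply/funext => s; rewrite derive1E; have [] := is_derive_ray x s.
rewrite /arc_length D1; under eq_Rintegral do rewrite gnorm_ray.
rewrite Rintegral_cst; last exact: measurable_itv.
rewrite [X in fine X](lebesgue_measure_itv `[0 : R, 1]%R) /= lte_fin ltr01.
by rewrite sube0 /= mulr1.
Qed.

Lemma C1_arc_ray x : C1_arc (fun t => t *: x).
Proof.
have D1 : derive1 (fun s : R => s *: x) = fun=> x.
  by apply/funext => s; rewrite derive1E; have [] := is_derive_ray x s.
split; first by move=> t; have [] := is_derive_ray x t.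
by rewrite D1 => t; exact: cvg_cst.
Qed.

Lemma C1_arc_continuous (c : R -> 'rV[R]_m) : C1_arc c -> forall i t,
  {for t, continuous (fun s => c s 0 i)} /\
  {for t, continuous (fun s => derive1 c s 0 i)}.
Proof.
move=> [dc cc] i t; split.
  apply/differentiable_continuous/derivable1_diffP.
  exact: (derivable_mxP _ _ _).1.
by apply: (@continuous_comp _ _ _ (derive1 c) (fun M : 'rV[R]_m => M 0 i));
  [exact: cc|exact: coord_continuous].
Qed.

Lemma continuous_gnorm (c : R -> 'rV[R]_m) : C1_arc c ->
  continuous (fun t => Defs.gnorm g (c t) (derive1 c t)).
Proof.
move=> /C1_arc_continuous C t.
have cc i := (C i t).1; have cd i := (C i t).2.
apply: (@continuous_comp _ _ _ (fun t => inner g (c t) (derive1 c t) (derive1 c t)) Num.sqrt).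
  rewrite (_ : (fun s => _) = fun s =>
    dot (derive1 c s *m (twist K L (c s))^T) (derive1 c s *m (twist K L (c s))^T)); last first.
    by apply/funext => s; rewrite inner_metric.
  have cw i : {for t, continuous (fun s => (derive1 c s *m (twist K L (c s))^T) 0 i)}.
    rewrite (_ : (fun s => _) = fun s => derive1 c s 0 i
       + dot (derive1 c s) (c s *m L) * (c s *m K) 0 i); last first.
      by apply/funext => s; rewrite mulmx_twistT mxE [X in _ + X = _]mxE.
    apply: cvgD; first exact: cd.
    apply: cvgM; last exact: continuous_mulmx_entry.
    by apply: continuous_dot => // j; exact: continuous_mulmx_entry.
  exact: continuous_dot.
exact: sqrt_continuous.
Qed.

(** The Euclidean norm is not differentiable at the origin, so it is replaced by the square root of
    [|c|^2 + e]. The derivative of this root is at most the speed by [gauss_cauchy_schwarz], and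
    integration gives the bound. *)
Lemma arc_length_ge (c : R -> 'rV[R]_m) (e : R) : 0 < e -> C1_arc c ->
  Num.sqrt (dot (c 1) (c 1) + e) - Num.sqrt (dot (c 0) (c 0) + e) <= arc_length g c.
Proof.
move=> e0 cC; have C := C1_arc_continuous cC.
pose N t := dot (c t) (c t) + e.
pose f t := dot (c t) (derive1 c t) / Num.sqrt (N t).
have N0 t : 0 < N t by rewrite /N ltr_wpDl ?dot_ge0.
have DN (t : R) : is_derive t 1 N (2 * dot (c t) (derive1 c t)).
  have Dc : is_derive t 1 c (derive1 c t) by rewrite derive1E; apply: derivableP; exact: cC.1.
  apply: is_derive_eq (is_derive_add (is_derive_dot Dc Dc) (is_derive_const e t 1)) _.
  by rewrite [dot (derive1 c t) _]dotC addr0 mulr_natl mulr2n.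
have DF (t : R) : is_derive t 1 (fun s => Num.sqrt (N s)) (f t).
  apply: is_derive_eq (is_derive_comp (is_derive1_sqrt (N0 t)) (DN t)) _.
  by rewrite /f invfM mulrACA mulVf ?mul1r 1?mulrC // pnatr_eq0.
have cN : continuous N.
  by move=> t; apply: cvgD; [apply: continuous_dot => i; exact: (C i t).1|exact: cvg_cst].
have cS : continuous (fun t => Num.sqrt (N t)).
  by move=> t; apply: (@continuous_comp _ _ _ N Num.sqrt); [exact: cN|exact: sqrt_continuous].
have cf : continuous f.
  move=> t; apply: cvgM.
    by apply: continuous_dot => i; [exact: (C i t).1|exact: (C i t).2].
  by apply: cvgV; [rewrite gt_eqF ?sqrtr_gt0|exact: cS].
have dF : derivable_oo_LRcontinuous (fun t => Num.sqrt (N t)) 0 1.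
  split; first by move=> t _; have [] := DF t.
    exact/cvg_at_right_filter/cS.
  exact/cvg_at_left_filter/cS.
have F'f : {in `]0, 1[, derive1 (fun t => Num.sqrt (N t)) =1 f}.
  by move=> t _; rewrite derive1E; have [] := DF t.
have FTC := continuous_FTC2 ltr01 (continuous_subspaceT cf) dF F'f.
have -> : Num.sqrt (N 1) - Num.sqrt (N 0) = \int[lebesgue_measure]_(t in `[0, 1]) f t.
  by rewrite /Rintegral FTC.
apply: le_Rintegral.
- exact: measurable_itv.
- apply: continuous_compact_integrable; first exact: segment_compact.
  exact: continuous_subspaceT.
- apply: continuous_compact_integrable; first exact: segment_compact.
  exact/continuous_subspaceT/continuous_gnorm.
move=> t _; rewrite /f ler_pdivrMr ?sqrtr_gt0 //.
apply: le_trans (gauss_cauchy_schwarz _ _) _.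
rewrite mulrC ler_wpM2l ?sqrtr_ge0 // enormE ler_wsqrtr //.
by rewrite /N lerDl ltW.
Qed.

Lemma chain_length_ge (e : R) x cs y : 0 < e -> joins x cs y ->
  Num.sqrt (dot y y + e) - Num.sqrt (dot x x + e) <= \sum_(c <- cs) arc_length g c.
Proof.
move=> e0; elim: cs x => [x ->|c cs IH x [cC c0 j]] /=; first by rewrite big_nil subrr.
rewrite big_cons -c0; have := lerD (arc_length_ge e0 cC) (IH _ j).
by rewrite addrC addrA subrK.
Qed.

Lemma chain_length_ge_enorm cs x : joins 0 cs x ->
  enorm x <= \sum_(c <- cs) arc_length g c.
Proof.
move=> j; apply/ler_addgt0Pr => e e0.
(* Regularising with the square of [e] makes the term at the origin exactly [e]. *)
have := chain_length_ge (exprn_gt0 2 e0) j.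
rewrite dot0l add0r sqrtr_sqr gtr0_norm // lerBlDr => H.
apply: le_trans H; rewrite enormE ler_wsqrtr // lerDl.
exact: sqr_ge0.
Qed.

(** The infimum is attained by the chain consisting of the straight ray alone. *)
Lemma gdist_metric0 x : gdist g 0 x = enorm x.
Proof.
rewrite /gdist; set E := [set _ | _].
have Ex : E (enorm x).
  exists [:: fun t => t *: x]; last by rewrite big_seq1 arc_length_ray.
  by split; [exact: C1_arc_ray|rewrite scale0r|rewrite /= scale1r].
have lE : lbound E (enorm x) by move=> l [cs j ->]; exact: chain_length_ge_enorm.
apply/eqP; rewrite eq_le; apply/andP; split.
  by apply: ge_inf => //; exists (enorm x).
by apply: lb_le_inf => //; exists (enorm x).
Qed.

End Distance.

(** * Closure properties of C^k functions *)

Section SmoothFunctions.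
Variables (R : realType) (m : nat).
Implicit Types (U V : set 'rV[R]_m) (f h : 'rV[R]_m -> R).

(** Differentiation rules hold at points of [U], whereas [partial] is a total function; regularity
    is carried across such local identities. Openness of [U] makes the partial derivatives agree as
    well. *)
Lemma Ck_on_ext k U f h : open U -> (forall x, U x -> f x = h x) ->
  Ck_on k U f -> Ck_on k U h.
Proof.
move=> oU; elim: k f h => [|k IH] f h fh /= [cf Df].
  split=> // x Ux; have nfh : \forall y \near x, f y = h y.
    by apply: filterS (open_nbhs_nbhs (conj oU Ux)) => y; exact: fh.
  rewrite /prop_for /continuous_at -(fh x Ux).
  by apply: cvg_trans (cf x Ux); exact: near_eq_cvg nfh.
have nfh x : U x -> \forall y \near x, f y = h y.
  by move=> Ux; apply: filterS (open_nbhs_nbhs (conj oU Ux)) => y; exact: fh.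
split.
  move=> x Ux; rewrite /prop_for /continuous_at -(fh x Ux).
  by apply: cvg_trans (cf x Ux); exact: near_eq_cvg (nfh x Ux).
move=> i; have [df CD] := Df i; split.
  by move=> x Ux; exact: near_eq_derivable (nfh x Ux) (df x Ux).
by apply: IH CD => x Ux; exact: near_eq_derive (nfh x Ux).
Qed.

Lemma Ck_on_sub k U V f : U `<=` V -> Ck_on k V f -> Ck_on k U f.
Proof.
move=> UV; elim: k f => [|k IH] f /= [cf Df]; first by split=> // x /UV; exact: cf.
split; first by move=> x /UV; exact: cf.
by move=> i; have [df CD] := Df i; split; [move=> x /UV; exact: df|exact: IH].
Qed.

Lemma Ck_onS k U f : Ck_on k.+1 U f -> Ck_on k U f.
Proof.
elim: k f => [|k IH] f [cf Df] //=; split=> // i.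
by have [df CD] := Df i; split=> //; exact: IH.
Qed.

Lemma Ck_on_cst k U (c : R) : Ck_on k U (fun=> c).
Proof.
have cc (d : R) (x : 'rV[R]_m) : U x -> {for x, continuous (fun=> d)} by move=> _; exact: cst_continuous.
elim: k c => [|k IH] c; split; [exact: cc|by []|exact: cc|move=> i].
split; first by move=> x _; exact: derivable_cst.
rewrite (_ : partial _ _ = fun=> 0); first exact: IH.
by apply/funext => x; rewrite /partial derive_cst.
Qed.

Lemma Ck_on_coord k U i : Ck_on k U (fun x => x 0 i).
Proof.
have Dc (x : 'rV[R]_m) j : is_derive x (delta_mx 0 j) (fun x => x 0 i) ((delta_mx 0 j : 'rV_m) 0 i).
  exact: (is_derive_entry 0 i (is_derive_id x (delta_mx 0 j))).
case: k => [|k]; (split; first by move=> x _; exact: coord_continuous) => // j.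
split; first by move=> x _; have [] := Dc x j.
rewrite (_ : partial _ _ = fun=> (delta_mx 0 j : 'rV_m) 0 i); first exact: Ck_on_cst.
by apply/funext => x; have [] := Dc x j.
Qed.

Lemma Ck_onD k U f h : open U -> Ck_on k U f -> Ck_on k U h ->
  Ck_on k U (fun x => f x + h x).
Proof.
move=> oU; elim: k f h => [|k IH] f h [cf Df] [ch Dh] /=.
  by split=> // x Ux; exact: (continuousD (cf x Ux) (ch x Ux)).
split; first by move=> x Ux; exact: (continuousD (cf x Ux) (ch x Ux)).
move=> i; have [df Cf] := Df i; have [dh Ch] := Dh i; split.
  by move=> x Ux; apply: derivableD; [exact: df|exact: dh].
apply: Ck_on_ext (IH _ _ Cf Ch) => // x Ux; rewrite /partial.
by rewrite (deriveD (df x Ux) (dh x Ux)).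
Qed.

Lemma Ck_onM k U f h : open U -> Ck_on k U f -> Ck_on k U h ->
  Ck_on k U (fun x => f x * h x).
Proof.
move=> oU; elim: k f h => [|k IH] f h Cf Ch.
  have [cf _] := Cf; have [ch _] := Ch.
  by split=> // x Ux; exact: (continuousM (cf x Ux) (ch x Ux)).
have [cf Df] := Cf; have [ch Dh] := Ch; split.
  by move=> x Ux; exact: (continuousM (cf x Ux) (ch x Ux)).
move=> i; have [df Cdf] := Df i; have [dh Cdh] := Dh i; split.
  by move=> x Ux; apply: derivableM; [exact: df|exact: dh].
have := Ck_onD oU (IH _ _ (Ck_onS Cf) Cdh) (IH _ _ (Ck_onS Ch) Cdf).
apply: Ck_on_ext => // x Ux; rewrite /partial.
by rewrite (deriveM (df x Ux) (dh x Ux)).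
Qed.

(** The derivative of [1 / f] is [- f' / f^2], so order [k] for [1 / f] and for [f'] yields order
    [k + 1] for [1 / f]. *)
Lemma Ck_onV k U f : open U -> (forall x, U x -> f x != 0) -> Ck_on k U f ->
  Ck_on k U (fun x => (f x)^-1).
Proof.
move=> oU f0; elim: k => [|k IH] Cf.
  have [cf _] := Cf.
  by split=> // x Ux; exact: (continuousV (f0 x Ux) (cf x Ux)).
have [cf Df] := Cf; split.
  by move=> x Ux; exact: (continuousV (f0 x Ux) (cf x Ux)).
move=> i; have [df Cdf] := Df i; split.
  by move=> x Ux; apply: derivableV; [exact: f0|exact: df].
have CV := IH (Ck_onS Cf).
have := Ck_onM oU (Ck_onM oU (Ck_on_cst k U (-1)) (Ck_onM oU CV CV)) Cdf.
apply: Ck_on_ext => // x Ux; rewrite /partial (deriveV (f0 x Ux) (df x Ux)).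
by rewrite /GRing.scale /= mulN1r expr2 invfM.
Qed.

Lemma Ck_on_sum k U n (F : 'I_n -> 'rV[R]_m -> R) : open U ->
  (forall i, Ck_on k U (F i)) -> Ck_on k U (fun x => \sum_i F i x).
Proof.
move=> oU CF; elim: n F CF => [|n IH] F CF.
  by under eq_fun do rewrite big_ord0; exact: Ck_on_cst.
by under eq_fun do rewrite big_ord_recl; apply: Ck_onD => //; exact: IH.
Qed.

Lemma Ck_onX k U f n : open U -> Ck_on k U f -> Ck_on k U (fun x => f x ^+ n).
Proof.
move=> oU Cf; elim: n => [|n IH].
  by under eq_fun do rewrite expr0; exact: Ck_on_cst.
by under eq_fun do rewrite exprS; exact: Ck_onM.
Qed.

Lemma Ck_on_mulmx k U n (A : 'M[R]_(m, n)) j : open U ->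
  Ck_on k U (fun x => (x *m A) 0 j).
Proof.
move=> oU; under eq_fun do rewrite mxE.
by apply: Ck_on_sum => // i; apply: Ck_onM => //; [exact: Ck_on_coord|exact: Ck_on_cst].
Qed.

End SmoothFunctions.

(** * The twisted metric is Riemannian *)

Section SmoothMetric.
Variables (R : realType) (m : nat) (K L : 'M[R]_m).
Hypotheses (KT : K^T = - K) (LT : L^T = - L) (KL : K *m L = 0).

Lemma riemannian_twisted : riemannian_metric (metric K L).
Proof.
split; [|exact: trmx_metric|by move=> x v; exact: inner_metric_gt0].
move=> i j k; have oT := @openT 'rV[R]_m.
(* The entries are polynomials in the coordinates of [x]. *)
rewrite (_ : (fun x => _) = fun x => (i == j)%:R + (x *m K) 0 i * (x *m L) 0 j
  + (x *m L) 0 i * (x *m K) 0 j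
  + (\sum_l (x *m K) 0 l * (x *m K) 0 l) * ((x *m L) 0 i * (x *m L) 0 j)); last first.
  by apply/funext => x; rewrite metricE.
have CK l := Ck_on_mulmx k K l oT; have CL l := Ck_on_mulmx k L l oT.
do !apply: Ck_onD => //; first exact: Ck_on_cst.
- exact: Ck_onM.
- exact: Ck_onM.
- apply: Ck_onM => //; last exact: Ck_onM.
  by apply: Ck_on_sum => // l; exact: Ck_onM.
Qed.

End SmoothMetric.

(** * Curvature at the origin of conformal multiples of the metric *)

Section ConformalCurvature.
Variables (R : realType) (m : nat) (K L : 'M[R]_m).
Hypotheses (KT : K^T = - K) (LT : L^T = - L) (KL : K *m L = 0).
Implicit Types (x u v w : 'rV[R]_m) (i j k l : 'I_m).

Let g := metric K L.

Lemma invmx_metricE x i j : invmx (g x) i j =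
  (i == j)%:R - (x *m K) 0 i * (x *m L) 0 j - (x *m L) 0 i * (x *m K) 0 j
  + dot (x *m L) (x *m L) * ((x *m K) 0 i * (x *m K) 0 j).
Proof.
have -> : invmx (g x) i j = ((delta_mx 0 i : 'rV_m) *m invmx (g x)) 0 j.
  by rewrite -rowE [RHS]mxE.
rewrite invmx_metric // [_ *m (_ *m (_ - _))]mulmxA !mulmxBr !mulmx1 !mulmx_outer.
rewrite dotDl dotNl dotZl.
rewrite ![dot (delta_mx 0 i) _]dotC !dot_delta.
move: (x *m K) (x *m L) => a b; set d := dot b b.
rewrite !mxE /= [j == i]eq_sym.
by ring.
Qed.

(** Apart from the identity, the terms of the inverse are of order at least two in [x]. *)
Lemma is_derive_invmx_metric0 w i j :
  is_derive 0 w (fun x => invmx (g x) i j) 0.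
Proof.
under eq_fun do rewrite invmx_metricE.
have D (A : 'M[R]_m) k : is_derive 0 w (fun y : 'rV[R]_m => (y *m A) 0 k) ((w *m A) 0 k).
  exact: is_derive_entry (is_derive_mulmx A (is_derive_id 0 w)).
have DA (A : 'M[R]_m) : is_derive 0 w (fun y : 'rV[R]_m => y *m A) (w *m A).
  exact: is_derive_mulmx (is_derive_id 0 w).
apply: is_derive_eq (is_derive_add (is_derive_add (is_derive_add
  (is_derive_const (i == j)%:R 0 w) (is_derive_opp (is_derive_mul (D K i) (D L j))))
  (is_derive_opp (is_derive_mul (D L i) (D K j))))
  (is_derive_mul (is_derive_dot (DA L) (DA L)) (is_derive_mul (D K i) (D K j)))) _.
rewrite !mul0mx !dot0l !dot0r; move: (w *m K) (w *m L) => a b; rewrite !mxE.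
by ring.
Qed.

Lemma invmx_metric0 i j : invmx (g 0) i j = (i == j)%:R.
Proof. by rewrite /g metric0 invmx1 mxE. Qed.

Lemma dmetric0 u i j : dmetric K L u 0 i j = 0.
Proof.
rewrite /dmetric !mul0mx !dot0l !dot0r; move: (u *m K) (u *m L) => a b; rewrite !mxE /=.
by ring.
Qed.

(** Second derivative at the origin of the metric entry [i j] along [u] and [w]. It sees only the
    quadratic part [a_i b_j + b_i a_j], the last term of [metricE] being quartic. *)
Definition hess_metric u w i j : R :=
  (u *m K) 0 i * (w *m L) 0 j + (w *m K) 0 i * (u *m L) 0 j
  + (u *m L) 0 i * (w *m K) 0 j + (w *m L) 0 i * (u *m K) 0 j.

Lemma is_derive_dmetric0 u w i j :
  is_derive 0 w (fun x => dmetric K L u x i j) (hess_metric u w i j).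
Proof.
have D (A : 'M[R]_m) k : is_derive 0 w (fun y : 'rV[R]_m => (y *m A) 0 k) ((w *m A) 0 k).
  exact: is_derive_entry (is_derive_mulmx A (is_derive_id 0 w)).
have DA (A : 'M[R]_m) : is_derive 0 w (fun y : 'rV[R]_m => y *m A) (w *m A).
  exact: is_derive_mulmx (is_derive_id 0 w).
have C c := @is_derive_const R 'rV[R]_m c 0 w.
have Cv v : is_derive 0 w (fun _ : 'rV[R]_m => v) 0 by exact: is_derive_cst.
rewrite /dmetric /=.
apply: is_derive_eq (is_derive_add (is_derive_add
  (is_derive_add (is_derive_mul (C ((u *m K) 0 i)) (D L j))
                 (is_derive_mul (D K i) (C ((u *m L) 0 j))))
  (is_derive_add (is_derive_mul (C ((u *m L) 0 i)) (D K j))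
                 (is_derive_mul (D L i) (C ((u *m K) 0 j)))))
  (is_derive_add
    (is_derive_mul (is_derive_add (is_derive_dot (Cv (u *m K)) (DA K))
                                  (is_derive_dot (DA K) (Cv (u *m K))))
                   (is_derive_mul (D L i) (D L j)))
    (is_derive_mul (is_derive_dot (DA K) (DA K))
      (is_derive_add (is_derive_mul (C ((u *m L) 0 i)) (D L j))
                     (is_derive_mul (D L i) (C ((u *m L) 0 j))))))) _.
rewrite /hess_metric !mul0mx !dot0l !dot0r.
move: (u *m K) (u *m L) (w *m K) (w *m L) => a b a' b'; rewrite !mxE.
by ring.
Qed.

Variables (U : set 'rV[R]_m) (phi : 'rV[R]_m -> R).
Hypotheses (oU : open U) (U0 : U 0) (Cphi : Ck_on 2 U phi).

Let G x := expR (2 * phi x) *: g x.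

Lemma derivable_phi x i : U x -> derivable phi x (delta_mx 0 i).
Proof. by move=> Ux; have [_ /(_ i)[+ _]] := Cphi; exact. Qed.

Lemma derivable_dphi x i j : U x -> derivable (partial j phi) x (delta_mx 0 i).
Proof. by move=> Ux; have [_ /(_ j)[_ [_ /(_ i)[+ _]]]] := Cphi; exact. Qed.

(* Twice the Christoffel symbol of the first kind of G, divided by its
   conformal factor. *)
Definition conf_christoffel i j l x : R :=
  (2 * partial i phi x * g x j l + 2 * partial j phi x * g x i l
   - 2 * partial l phi x * g x i j)
  + (dmetric K L (delta_mx 0 i) x j l + dmetric K L (delta_mx 0 j) x i l
     - dmetric K L (delta_mx 0 l) x i j).

Lemma partial_conformal x l i j : U x -> partial l (fun y => G y i j) x =
  expR (2 * phi x) * (2 * partial l phi x * g x i j + dmetric K L (delta_mx 0 l) x i j).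
Proof.
move=> Ux.
have Dphi : is_derive x (delta_mx 0 l) phi (partial l phi x).
  by apply: derivableP; exact: derivable_phi.
have De := @is_derive_comp _ _ expR (fun y => 2 * phi y) x _ _ _ (is_derive_expR _)
  (is_derive_scale 2 Dphi).
rewrite (_ : (fun y => G y i j) = fun y => expR (2 * phi y) * g y i j); last first.
  by apply/funext => y; rewrite mxE.
have [_ H] := is_derive_mul De (is_derive_metric K L x (delta_mx 0 l) i j).
by rewrite [LHS]H /g; ring.
Qed.

(** The factor [expR (2 * phi x)] in the derivatives of [G] cancels against the one in the inverse
    of [G]. *)
Lemma christoffel_conformal k i j x : U x -> christoffel G k i j x =
  2^-1 * \sum_l invmx (g x) k l * conf_christoffel i j l x.
Proof.
move=> Ux; congr (_ * _); apply: eq_bigr => l _.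
have e0 : expR (2 * phi x) != 0 by rewrite gt_eqF ?expR_gt0.
rewrite !partial_conformal // /G invmxZ; last by rewrite unitmxZ ?unitfE // metric_unit.
rewrite mxE /conf_christoffel.
by move: (expR _) e0 => e e0; field.
Qed.

Lemma metric0_off i j : i != j -> g 0 i j = 0.
Proof. by move=> /negbTE ij; rewrite /g metric0 mxE ij. Qed.

(** For distinct indices the gradient of [phi] is multiplied by off-diagonal entries of [g 0], which
    is the identity, and the derivatives of [g] vanish at the origin. *)
Lemma conf_christoffel0 i j l : i != j -> j != l -> i != l ->
  conf_christoffel i j l 0 = 0.
Proof.
move=> ij jl il; rewrite /conf_christoffel !dmetric0 !metric0_off //.
move: (partial i phi 0) (partial j phi 0) (partial l phi 0) => *.
by ring.
Qed.

Lemma christoffel_conformal0 k i j : i != j -> j != k -> i != k ->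
  christoffel G k i j 0 = 0.
Proof.
move=> ij jk ik; rewrite christoffel_conformal // (bigD1 k) //= big1.
  by rewrite conf_christoffel0 // mulr0 addr0 mulr0.
by move=> l lk; rewrite invmx_metric0 eq_sym (negbTE lk) mul0r.
Qed.

(** Differentiability is asserted for all indices, since a Christoffel symbol sums over [l]. For
    distinct ones, second derivatives of [phi] meet off-diagonal entries of [g 0], and first
    derivatives meet those of [g] at the origin, so [phi] drops out. *)
Lemma is_derive_conf_christoffel0 n i j l :
  exists dE, is_derive 0 (delta_mx 0 n) (conf_christoffel i j l) dE /\
   (i != j -> j != l -> i != l -> dE =
      hess_metric (delta_mx 0 i) (delta_mx 0 n) j l
      + hess_metric (delta_mx 0 j) (delta_mx 0 n) i l
      - hess_metric (delta_mx 0 l) (delta_mx 0 n) i j).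
Proof.
pose w : 'rV[R]_m := delta_mx 0 n.
have Dphi a : is_derive 0 w (partial a phi) ('D_w (partial a phi) 0).
  by apply: derivableP; exact: derivable_dphi.
have D a b c := is_derive_mul (is_derive_scale 2 (Dphi a))
  (is_derive_metric K L 0 w b c).
have H a b c := is_derive_dmetric0 (delta_mx 0 a) w b c.
eexists; split.
  exact: (is_derive_add
    (is_derive_add (is_derive_add (D i j l) (D j i l)) (is_derive_opp (D l i j)))
    (is_derive_add (is_derive_add (H i j l) (H j i l)) (is_derive_opp (H l i j)))).
move=> ij jl il; rewrite !dmetric0 !metric0_off //.
move: ('D_w _ 0) ('D_w _ 0) ('D_w _ 0) (partial i phi 0) (partial j phi 0) (partial l phi 0).
move: (hess_metric _ _ _ _) (hess_metric _ _ _ _) (hess_metric _ _ _ _) => *.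
by ring.
Qed.

Lemma partial_christoffel_conformal0 n k i j : i != j -> j != k -> i != k ->
  partial n (christoffel G k i j) 0 = 2^-1 *
    (hess_metric (delta_mx 0 i) (delta_mx 0 n) j k
     + hess_metric (delta_mx 0 j) (delta_mx 0 n) i k
     - hess_metric (delta_mx 0 k) (delta_mx 0 n) i j).
Proof.
move=> ij jk ik; have [dE DE] := choice (is_derive_conf_christoffel0 n i j).
rewrite -(DE k).2 //.
(* The formula for the symbols holds on the open set [U], hence near the origin, which determines
   the derivative there. *)
have -> : partial n (christoffel G k i j) 0 =
    partial n (fun x => 2^-1 * \sum_l invmx (g x) k l * conf_christoffel i j l x) 0.
  apply: near_eq_derive; apply: filterS (open_nbhs_nbhs (conj oU U0)) => x Ux.
  exact: christoffel_conformal.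
have [_ D] := is_derive_scale 2^-1 (is_derive_bigsum (fun l =>
  is_derive_mul (is_derive_invmx_metric0 (delta_mx 0 n) k l) (DE l).1)).
(* The inverse metric is the identity to first order, so only [l = k] survives. *)
rewrite [LHS]D; congr (_ * _); rewrite (bigD1 k) //= big1.
  by rewrite mul0r add0r addr0 invmx_metric0 eqxx mul1r.
by move=> l lk; rewrite invmx_metric0 eq_sym (negbTE lk) !mul0r addr0.
Qed.

(** The value is free of [phi]: with four distinct indices it is a component of the conformally
    invariant Weyl tensor. The Hessian terms along both [i] and [j] cancel by symmetry. *)
Lemma curvature_conformal0 i j k l :
  i != j -> i != k -> i != l -> j != k -> j != l -> k != l ->
  curvature G i j k l 0 =
  2^-1 * (hess_metric (delta_mx 0 k) (delta_mx 0 i) j l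
          - hess_metric (delta_mx 0 l) (delta_mx 0 i) j k
          - hess_metric (delta_mx 0 k) (delta_mx 0 j) i l
          + hess_metric (delta_mx 0 l) (delta_mx 0 j) i k).
Proof.
move=> ij ik il jk jl kl.
rewrite /curvature !partial_christoffel_conformal0 // big1 => [|n _].
  by rewrite /hess_metric; ring.
(* Whatever the value of [n], one of the two symbols has three distinct indices. *)
have zero a b : a != b -> a != k -> a != l -> b != k -> b != l ->
    christoffel G l a n 0 * christoffel G n b k 0 = 0.
  move=> ab ak al bk bl.
  have [->|nb] := eqVneq n b; first by rewrite christoffel_conformal0 ?mul0r.
  have [->|nk] := eqVneq n k; first by rewrite christoffel_conformal0 ?mul0r.
  by rewrite [X in _ * X]christoffel_conformal0 ?mulr0 // eq_sym.
by rewrite !zero // ?subrr // eq_sym.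
Qed.

End ConformalCurvature.

(** * Rotation generators and failure of conformal flatness *)

Section RotationGenerators.
Variables (R : realType) (m : nat).
Implicit Types p q r s : 'I_m.

Definition rot_gen p q : 'M[R]_m := delta_mx p q - delta_mx q p.

Lemma trmx_rot_gen p q : (rot_gen p q)^T = - rot_gen p q.
Proof. by rewrite /rot_gen linearB /= !trmx_delta opprB. Qed.

Lemma mul_rot_gen p q r s : p != r -> p != s -> q != r -> q != s ->
  rot_gen p q *m rot_gen r s = 0.
Proof.
move=> pr ps qr qs; rewrite /rot_gen mulmxBl !mulmxBr.
by rewrite !mul_delta_mx_0 // ?subrr.
Qed.

Lemma twisted_not_conformally_flat p q r s :
  p != q -> p != r -> p != s -> q != r -> q != s -> r != s ->
  ~ conformally_flat (metric (rot_gen p q) (rot_gen r s)).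
Proof.
move=> pq pr ps qr qs rs /(_ 0)[U [phi [oU U0 Cphi flat]]].
have := flat p q r s 0 U0.
rewrite (curvature_conformal0 (trmx_rot_gen p q) (trmx_rot_gen r s)
  (mul_rot_gen pr ps qr qs) oU U0 (Cphi 2)) //.
(* Each of the four Hessian terms, taken with its sign, equals 1, so this curvature component would
   be 2. *)
rewrite /hess_metric -!rowE !mxE /=.
have E (a b : 'I_m) : a != b -> (a == b) = false /\ (b == a) = false.
  by move=> ab; rewrite [b == a]eq_sym (negbTE ab).
have [[e1 e2] [e3 e4] [e5 e6]] := And3 (E _ _ pq) (E _ _ pr) (E _ _ ps).
have [[e7 e8] [e9 e10] [e11 e12]] := And3 (E _ _ qr) (E _ _ qs) (E _ _ rs).
rewrite ?eqxx ?e1 ?e2 ?e3 ?e4 ?e5 ?e6 ?e7 ?e8 ?e9 ?e10 ?e11 ?e12 /=.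
by lra.
Qed.

End RotationGenerators.

(** * Jacobians of linear maps and continuity of the Euclidean norm *)

Section LinearMap.
Variables (R : realType) (m : nat).

Lemma continuous_row (T : topologicalType) (F : T -> 'rV[R]_m) t :
  (forall i, {for t, continuous (fun s => F s 0 i)}) -> {for t, continuous F}.
Proof.
move=> cF A [P Pn PA].
suff : \forall s \near t, forall i, P 0 i (F s 0 i).
  by apply: filterS => s Ps; apply: PA => i j; rewrite ord1.
by apply: filter_forall => i; exact: (cF i).
Qed.

Lemma jacobian_mulmx (A : 'M[R]_m) x : jacobian (fun y : 'rV[R]_m => y *m A) x = A.
Proof.
have dA : differentiable (fun y : 'rV[R]_m => y *m A) x.
  apply: (@linear_differentiable _ _ _ (mulmxr A)) => y; apply: continuous_row => i.
  by apply: continuous_mulmx_entry => j; exact: coord_continuous.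
(* Rows of the Jacobian are derivatives along basis vectors, here the rows of [A]. *)
apply/row_matrixP => i; rewrite !rowE -deriveEjacobian //.
by have [] := is_derive_mulmx A (is_derive_id x (delta_mx 0 i)).
Qed.

Lemma continuous_normsq : continuous (fun x : 'rV[R]_m => dot x x).
Proof. by move=> x; apply: continuous_dot => i; exact: coord_continuous. Qed.

Lemma continuous_enorm : continuous (@enorm R m).
Proof.
move=> x; rewrite (_ : @enorm R m = Num.sqrt \o (fun x => dot x x)); last first.
  by apply/funext => y; rewrite enormE.
by apply: continuous_comp; [exact: continuous_normsq|exact: sqrt_continuous].
Qed.

Lemma open_neq0 : open [set x : 'rV[R]_m | dot x x != 0].
Proof.
apply: (@open_comp _ _ (fun x : 'rV[R]_m => dot x x) [set s | s != 0]).
  by move=> x _; exact: continuous_normsq.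
exact: open_neq.
Qed.

End LinearMap.

(** * Radial harmonic functions, injectivity radius and volume density *)

Section RadialHarmonic.
Variables (R : realType) (m : nat).
Implicit Types (x u : 'rV[R]_m).

Lemma is_derive_normsqVX n x u : dot x x != 0 ->
  is_derive x u (fun y => (dot y y)^-1 ^+ n)
    (- (2 * n%:R * dot x u * (dot x x)^-1 ^+ n.+1)).
Proof.
move=> x0.
have DV := @is_derive_inv _ _ (fun y => dot y y) x u _ x0
  (is_derive_dot (is_derive_id x u) (is_derive_id x u)).
elim: n => [|n IH].
  rewrite mulr0 !mul0r oppr0; under eq_fun do rewrite expr0.
  exact: is_derive_const.
under eq_fun do rewrite exprS.
apply: is_derive_eq (is_derive_mul DV IH) _.
rewrite [dot u x]dotC -exprVn -natr1 !exprS expr0.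
by move: (_^-1) (_ ^+ n) => t tn; ring.
Qed.

Variables (K L : 'M[R]_m).
Hypotheses (KT : K^T = - K) (LT : L^T = - L) (KL : K *m L = 0).
Let g := metric K L.

(** As [m = 2 (n + 1)], the function is [|y|^(2 - m)]. Its gradient is radial, hence fixed by the
    inverse metric, and the determinant is 1, so the equation is the Euclidean one. *)
Lemma laplacian_radial n x : m = n.+1.*2 -> dot x x != 0 ->
  laplacian g (fun y => (dot y y)^-1 ^+ n) x = 0.
Proof.
move=> mE x0; rewrite /laplacian /g det_metric // sqrtr1 invr1 mul1r.
(* The components of the Euclidean gradient, a multiple of [y]. *)
pose h (i : 'I_m) (y : 'rV[R]_m) := - (2 * n%:R) * (y 0 i * (dot y y)^-1 ^+ n.+1).
have flux y i : dot y y != 0 -> Num.sqrt (\det (g y)) *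
    \sum_j invmx (g y) i j * partial j (fun y => (dot y y)^-1 ^+ n) y = h i y.
  move=> y0; rewrite det_metric // sqrtr1 mul1r /h.
  have U := metric_unit KT LT KL y.
  have yV : y *m invmx (g y) = y.
    by rewrite -{1}[y]scale1r -(metric_radial KT LT y 1) scale1r mulmxK.
  have -> : y 0 i = \sum_j y 0 j * invmx (g y) j i by rewrite -{1}yV mxE.
  rewrite mulr_suml mulr_sumr; apply: eq_bigr => j _.
  have [_ D] := is_derive_normsqVX n (delta_mx 0 j) y0.
  rewrite [partial j _ y]D.
  rewrite dot_delta /g -[in LHS](trmx_metric K L y) -trmx_inv mxE.
  by ring.
have Dh i : partial i (h i) x = - (2 * n%:R) * ((dot x x)^-1 ^+ n.+1
    - 2 * n.+1%:R * x 0 i ^+ 2 * (dot x x)^-1 ^+ n.+2).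
  have [_ H] := is_derive_scale (- (2 * n%:R)) (is_derive_mul
    (is_derive_entry 0 i (is_derive_id x (delta_mx 0 i)))
    (is_derive_normsqVX n.+1 (delta_mx 0 i) x0)).
  rewrite [LHS]H dot_delta mxE !eqxx /=.
  by ring.
transitivity (\sum_i partial i (h i) x).
  apply: eq_bigr => i _; apply: near_eq_derive.
  have : \forall y \near x, dot y y != 0.
    exact: open_nbhs_nbhs (conj (@open_neq0 R m) x0).
  by apply: filterS => y; exact: flux.
under eq_bigr do rewrite Dh.
rewrite -mulr_sumr sumrB sumr_const card_ord -mulr_suml -mulr_sumr.
have -> : \sum_i x 0 i ^+ 2 = dot x x by apply: eq_bigr => i _; rewrite expr2.
rewrite [_ ^+ n.+2]exprS mulrA -[_ * dot x x * _]mulrA divff // mulr1 -[_ *+ m]mulr_natl.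
(* The divergence of [h] is a multiple of [m - 2 (n + 1)]. *)
have -> : m%:R = 2 * n.+1%:R :> R by rewrite mE -muln2 natrM mulrC.
by rewrite subrr mulr0.
Qed.

(** The exponential map is the identity, so every positive radius is admissible and the injectivity
    radius is infinite. *)
Lemma le_injectivity_radius (rho : R) : 0 < rho -> (rho%:E <= injectivity_radius g 0)%E.
Proof.
move=> rho0; apply: ereal_sup_ubound; exists rho => //.
have E : tangent_ball g 0 rho = [set v | enorm v < rho].
  by apply/seteqP; split=> v; rewrite /tangent_ball /= gnorm0.
have oB : open (tangent_ball g 0 rho).
  rewrite E; apply: (@open_comp _ _ (@enorm R m) [set s | s < rho]).
    by move=> x _; exact: continuous_enorm.
  exact: open_lt.
have sI U : smooth_map_on U (id : 'rV[R]_m -> 'rV[R]_m) by move=> i k; exact: Ck_on_coord.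
split=> //; first by move=> v _; exists v; exact: exp_rel_ray.
rewrite /g expmap_id //; split; [exact: sI|by rewrite image_id|].
by exists id; split.
Qed.

Lemma centrally_harmonic_twisted n : m = n.+1.*2 -> (0 < n)%N ->
  centrally_harmonic g 0.
Proof.
(* The profile [rho^(2 - m)], written through [rho ^+ 2] to be rational in the coordinates. *)
move=> mE n0; pose fc (rho : R) := (rho ^+ 2)^-1 ^+ n.
have fE : (fun x => fc (gdist g 0 x)) = fun x => (dot x x)^-1 ^+ n.
  by apply/funext => x; rewrite /fc gdist_metric0 // enormE sqr_sqrtr ?dot_ge0.
have ball_neq0 x : punctured_ball g 0 x -> dot x x != 0.
  by case; rewrite gdist_metric0 // dot_eq0 -enorm_eq0 lt_def => /andP[].
exists fc; rewrite fE; split.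
- move=> k; apply: (@Ck_on_sub _ _ _ _ [set x | dot x x != 0]) => //.
  have oU := @open_neq0 R m.
  apply: Ck_onX => //; apply: Ck_onV => //; apply: Ck_on_sum => // i.
  by apply: Ck_onM => //; exact: Ck_on_coord.
- have m0 : (0 < m)%N by rewrite mE.
  pose e : 'rV[R]_m := delta_mx 0 (Ordinal m0).
  have ee : dot e e = 1 by rewrite dot_delta mxE !eqxx.
  have ball_e (t : R) : 0 < t -> punctured_ball g 0 (t *: e).
    move=> t0; rewrite /punctured_ball /= gdist_metric0 // enormZ enormE ee sqrtr1 mulr1 gtr0_norm //.
    split=> //; apply: (@lt_le_trans _ _ (t + 1)%:E); first by rewrite lte_fin ltrDl.
    by apply: le_injectivity_radius; rewrite addr_gt0.
  (* At distances 1 and 2 the values are 1 and [4^(-n)], which differ because [n] is positive. *)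
  exists (1 *: e), (2 *: e); split; [exact: ball_e|exact: ball_e|].
  rewrite !(dotZl, dotZr) ee !mulr1 invr1 expr1n eq_sym lt_eqF //.
  have four1 : (2 * 2 : R)^-1 < 1 by rewrite invf_lt1; lra.
  by rewrite exprn_ilt1 // ?invr_ge0 -?lt0n //; lra.
- by move=> x /ball_neq0 x0; exact: laplacian_radial.
Qed.

(** The chart is the linear map with matrix [A], and [g] has determinant 1 everywhere. Since
    [metric 0] is the identity, [A] is orthogonal and the determinant in the chart is again 1. *)
Lemma volume_density_twisted (A : 'M[R]_m) (xi : 'rV[R]_m) :
  orthonormal_frame g 0 A -> volume_density g 0 A xi = enorm xi ^+ m.-1.
Proof.
rewrite /orthonormal_frame /g metric0 mulmx1 => AA.
rewrite /volume_density /normal_metric /normal_chart expmap_id //.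
rewrite jacobian_mulmx /= det_mulmx [\det (A *m _)]det_mulmx det_metric // mulr1.
by rewrite -det_mulmx AA det1 sqrtr1 mulr1.
Qed.

End RadialHarmonic.

Theorem theorem1p8 (R : realType) (m : nat) (m_ge4 : (4 <= m)%N)
    (m_even : ~~ odd m) :
  exists g : 'rV[R]_m -> 'M[R]_m,
    [/\ riemannian_metric g,
        centrally_harmonic g 0,
        ~ conformally_flat g &
        forall (A : 'M[R]_m) (xi : 'rV[R]_m),
          orthonormal_frame g 0 A ->
          0 < enorm xi -> ((enorm xi)%:E < injectivity_radius g 0)%E ->
          volume_density g 0 A xi = enorm xi ^+ m.-1].
Proof.
(* Evenness gives [m = 2 (n + 1)], and [4 <= m] makes [n] positive, so that [|x|^(2 - m)] is not
   constant. *)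
have [n mE n0] : exists2 n, m = n.+1.*2 & (0 < n)%N.
  have := odd_double_half m; rewrite (negbTE m_even) add0n.
  by case: m./2 m_ge4 => [|[|n]] + mE; rewrite -mE //; exists n.+1.
have lt3 i : (i < 4 -> i < m)%N by move=> /leq_trans; exact.
pose o i (Hi : (i < 4)%N) := Ordinal (lt3 i Hi).
have neq i j Hi Hj : i != j -> o i Hi != o j Hj by rewrite -val_eqE.
(* Four distinct indices, available because [m] is at least 4, for the two orthogonal planes. *)
pose p := o 0 isT; pose q := o 1 isT; pose r := o 2 isT; pose s := o 3 isT.
have KT := trmx_rot_gen R p q; have LT := trmx_rot_gen R r s.
have KL : rot_gen R p q *m rot_gen R r s = 0 by apply: mul_rot_gen; exact: neq.
exists (metric (rot_gen R p q) (rot_gen R r s)); split.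
- exact: riemannian_twisted.
- exact: centrally_harmonic_twisted mE n0.
- by apply: twisted_not_conformally_flat; exact: neq.
- by move=> A xi oA _ _; exact: volume_density_twisted.
Qed.
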